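(* Let $X$ be a finite-dimensional real Hilbert space. Let $f\colon\mathbb{R}\to\,]-\infty,+\infty]$ be convex, lower semicontinuous, and proper, let $a\in X$ be such that $\|a\|=1$, set $F\colon X\to\,]-\infty,+\infty]\colon x\mapsto f(\langle a,x\rangle)$, and let $T=P_F:=(\operatorname{Id}+\partial F)^{-1}$ be the associated proximity operator. Let $x\in X$. Then $$(\forall n\in\mathbb{N})\quad T^nx=P_{\{a\}^{\perp}}(x)+P_f^n(\langle a,x\rangle)\,a,$$ where $P_f:=(\operatorname{Id}+\partial f)^{-1}$ is the proximity operator of $f$. Consequently, if $f$ is bounded below but without minimizers, then $T$ admits cosmic convergence and $(Q_n(x))_{n\in\mathbb{N}}=(T^nx/\|T^nx\|)_{n\in\mathbb{N}}$ converges either to $+a$ or to $-a$.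
   Context: $\partial$ denotes the convex subdifferential. $P_{\{a\}^{\perp}}$ is the orthogonal projector onto $\{a\}^{\perp}=\{y\in X:\langle a,y\rangle=0\}$. $P_f^n$ denotes the $n$-fold composition of $P_f\colon\mathbb{R}\to\mathbb{R}$. $T$ admits cosmic convergence means that for every $x\in X$ the sequence $Q_n(x):=T^nx/\|T^nx\|$ (well defined for all sufficiently large $n$) converges. *)

(* Defs.v *)
From HB Require Import structures.
From mathcomp Require Import all_boot all_order all_algebra.
From mathcomp Require Import sesquilinear.
From mathcomp Require Import all_classical all_reals all_analysis.

Set Implicit Arguments.
Unset Strict Implicit.
Unset Printing Implicit Defensive.

Import Order.TTheory GRing.Theory Num.Theory.
Import numFieldNormedType.Exports.

Local Open Scope classical_set_scope.
Local Open Scope ring_scope.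

Definition finite_dimensional (R : realType) (X : lmodType R) : Prop :=
  exists (m : nat) (e : 'I_m -> X),
    forall x, exists c : 'I_m -> R, x = \sum_i c i *: e i.

(* Together with [finite_dimensional] (which gives completeness), this makes
   the normed space [X] a finite-dimensional real Hilbert space. *)
Definition norm_of_dot (R : realType) (X : normedModType R)
    (dot : {dot X for idfun}) : Prop :=
  forall x : X, `|x| = Num.sqrt (dot x x).

Section ExtendedRealValued.
Variables (R : realType) (f : R -> \bar R).

(* The first conjunct says that [f] takes its values in ]-oo, +oo]. *)
Definition proper_fun : Prop :=
  (forall t, (-oo < f t)%E) /\ exists t, (f t < +oo)%E.

(* Only meaningful when [f] never takes the value -oo. *)
Definition econvex : Prop :=
  forall (s t l : R), 0 < l < 1 ->
    (f (l * s + (1 - l) * t) <= l%:E * f s + (1 - l)%:E * f t)%E.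

Definition bounded_below_fun : Prop := exists m : R, forall t, (m%:E <= f t)%E.

Definition minimizer (t : R) : Prop := forall s, (f t <= f s)%E.

End ExtendedRealValued.

(* The inner product is an explicit argument, so that the definitions apply
   both to X and to the real line with the product [*%R]. *)
Section Proximity.
Variables (R : realType) (X : zmodType) (ip : X -> X -> R).

Definition subdifferential (F : X -> \bar R) (x : X) : set X :=
  [set u | forall y, ((ip (y - x) u)%:E + F x <= F y)%E].

Definition id_plus (A : X -> set X) (x : X) : set X := [set x + u | u in A x].

Definition set_valued_inverse (A : X -> set X) (y : X) : set X :=
  [set x | A x y].

(* When [F] is proper, lower semicontinuous and convex on a Hilbert space, the
   set from which the value is taken is a singleton at every point. *)
Definition prox (F : X -> \bar R) (x : X) : X :=
  xget 0 (set_valued_inverse (id_plus (subdifferential F)) x).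

Definition orthogonal_set (A : set X) : set X :=
  [set y | forall z, A z -> ip z y = 0].

(* The set below is a singleton when [V] is a finite-dimensional subspace. *)
Definition orthogonal_projector (V : set X) (x : X) : X :=
  xget 0 [set p | V p /\ orthogonal_set V (x - p)].

End Proximity.

Section Cosmic.
Variables (R : realType) (X : normedModType R) (T : X -> X).

(* Total: it takes the junk value 0 when [iter n T x] is 0. *)
Definition cosmic_seq (x : X) (n : nat) : X :=
  `|iter n T x|^-1 *: iter n T x.

Definition cosmic_convergence : Prop :=
  forall x, (\forall n \near \oo, iter n T x != 0) /\ cvgn (cosmic_seq x).

End Cosmic.

(* Main.v *)
Require Import Defs.
From mathcomp Require Import all_boot all_order all_algebra.
From mathcomp Require Import sesquilinear.
From mathcomp Require Import all_classical all_reals all_analysis.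
From mathcomp Require Import ring lra.

(* The inclusion defining the proximal point of [F = f o <a, .>] only moves a
   point along [a], so [T] fixes the component orthogonal to [a] and acts as
   [Pf] on the coordinate [<a, x>]; this needs that the proximal point exists
   and is unique.
   [Pf] is firmly nonexpansive, hence nondecreasing and continuous, and its
   fixed points are the minimizers of [f]. Without minimizers, the orbits of
   [Pf] are therefore monotone and do not converge, so they tend to [+oo] or
   [-oo]; after normalization the fixed orthogonal component vanishes in the
   limit. *)

Import Order.TTheory GRing.Theory Num.Theory.
Import numFieldNormedType.Exports.

Local Open Scope classical_set_scope.
Local Open Scope ring_scope.

Set Implicit Arguments.
Unset Strict Implicit.
Unset Printing Implicit Defensive.

(** * Monotonicity of subdifferentials and uniqueness of proximal points *)

Lemma subdifferential_fin_num (R : realType) (X : zmodType) (ip : X -> X -> R)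
    (F : X -> \bar R) (x u : X) :
  (forall y, (-oo < F y)%E) -> (exists y, (F y < +oo)%E) ->
  subdifferential ip F x u -> F x \is a fin_num.
Proof.
move=> FNy [y Fy] /(_ y); move: (FNy x) Fy (FNy y).
by case: (F x) => [r||] //; case: (F y).
Qed.

(** Each subgradient inequality is tested at the other base point; in the sum the values of [F],
    which are finite, cancel. *)
Lemma subdifferential_monotone (R : realType) (X : zmodType)
    (ip : X -> X -> R) (F : X -> \bar R) (x y u v : X) :
  (forall w z, ip (- w) z = - ip w z) ->
  (forall w z t, ip w (z - t) = ip w z - ip w t) ->
  (forall z, (-oo < F z)%E) -> (exists z, (F z < +oo)%E) ->
  subdifferential ip F x u -> subdifferential ip F y v ->
  ip (y - x) (u - v) <= 0.
Proof.
move=> ipN ipB FNy Ffin Fxu Fyv.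
have := subdifferential_fin_num FNy Ffin Fyv.
have := subdifferential_fin_num FNy Ffin Fxu.
move: (Fxu y) (Fyv x).
case: (F x) => [r||] //; case: (F y) => [s||] //.
rewrite -!EFinD !lee_fin -[in ip (x - y)](opprB y x) ipN ipB => h1 h2 _ _.
lra.
Qed.

(* The last hypothesis is the inclusion [x \in p + subdifferential F p], whose
   solution is unique because the subdifferential is monotone. *)
Lemma prox_eq (R : realType) (X : zmodType) (ip : X -> X -> R)
    (F : X -> \bar R) (x p : X) :
  (forall w z, ip (- w) z = - ip w z) ->
  (forall w z t, ip w (z - t) = ip w z - ip w t) ->
  (forall w, ip w w <= 0 -> w = 0) ->
  (forall z, (-oo < F z)%E) -> (exists z, (F z < +oo)%E) ->
  subdifferential ip F p (x - p) -> prox ip F x = p.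
Proof.
move=> ipN ipB ip0 FNy Ffin Fp.
apply: xget_subset1; first by exists (x - p) => //; rewrite addrC subrK.
have sol q : set_valued_inverse (id_plus (subdifferential ip F)) x q ->
    subdifferential ip F q (x - q).
  by case=> u Fu <-; rewrite addrAC subrr add0r.
move=> {Fp}{}p q /sol Fp /sol Fq.
have := subdifferential_monotone ipN ipB FNy Ffin Fp Fq.
have -> : x - p - (x - q) = q - p by rewrite opprB addrC addrA subrK.
by move/ip0/eqP; rewrite subr_eq0 => /eqP.
Qed.

(** * Existence of proximal points on the real line *)

(* Near a point [t0] of its domain [f] is at least [f t0 - 1] by lower
   semicontinuity; convexity along the segments issued from [t0] propagates
   this to a bound of linear growth. *)
Lemma norm_minorant (R : realType) (f : R -> \bar R) :
  econvex f -> lower_semicontinuous f -> proper_fun f ->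
  exists b c t0 : R, 0 <= c /\ forall t, ((b - c * `|t - t0|)%:E <= f t)%E.
Proof.
move=> fcvx flsc [fNy [t0 ft0]].
have [r0 fr0] : exists r0, f t0 = r0%:E.
  by move: (fNy t0) ft0; case: (f t0) => // r _ _; exists r.
have [|V /nbhs_ballP[d /= d0 dV] fV] := flsc t0 (r0 - 1).
  by rewrite fr0 lte_fin; lra.
have e0 : 0 < d / 2 by rewrite divr_gt0.
set e := d / 2 in e0 *.
exists (r0 - 1), e^-1, t0; split=> [|t]; first by rewrite invr_ge0 ltW.
have [te|te] := ltP `|t - t0| d.
  apply: (@le_trans _ _ (r0 - 1)%:E).
    by rewrite lee_fin lerBlDr lerDl mulr_ge0// invr_ge0 ltW.
  by apply/ltW/fV/dV; rewrite /ball/= distrC.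
set n := `|t - t0| in te *.
have n0 : 0 < n by apply: lt_le_trans te.
(* With the weight [e / n], the combination of [t] and [t0] lies at distance exactly [e = d / 2]
   from [t0], hence inside the ball. *)
have l01 : 0 < e / n < 1.
  by rewrite divr_gt0//= ltr_pdivrMr// mul1r (lt_le_trans _ te)// /e; lra.
have := fcvx t t0 _ l01; set l := e / n in l01 *.
have /fV : V (l * t + (1 - l) * t0).
  apply: dV; rewrite /ball/=.
  have -> : t0 - (l * t + (1 - l) * t0) = - (l * (t - t0)) by ring.
  rewrite normrN normrM gtr0_norm; last by case/andP: l01.
  by rewrite -/n /l divfK ?gt_eqF// /e; lra.
move: (fNy t); rewrite fr0; case: (f t) => [r _|_|//]; last by rewrite leey.
move=> h1; rewrite -!EFinM -EFinD => /(lt_le_trans h1).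
rewrite lte_fin lee_fin => h.
have /andP[l0 l1] := l01.
have {}h : l * (r - r0 + l^-1) > 0 by rewrite mulrDr mulfV ?gt_eqF//; lra.
have -> : e^-1 * n = l^-1 by rewrite [RHS]invf_div mulrC.
rewrite pmulr_rgt0// in h; lra.
Qed.

Lemma le0_of_le_small_mul (R : realType) (A B : R) :
  (forall l, 0 < l < 1 -> A <= l * B) -> A <= 0.
Proof.
move=> AB; rewrite leNgt; apply/negP => A0.
have B0 : 0 <= `|B| by [].
have dn0 : 0 < A + `|B| + 1 by lra.
(* If [A] were positive, this value of [l] would lie in ]0, 1[ and give [l * B < A]. *)
have l0 : 0 < A / (A + `|B| + 1) by rewrite divr_gt0.
have l1 : A / (A + `|B| + 1) < 1 by rewrite ltr_pdivrMr//; lra.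
have := AB _ (introT andP (conj l0 l1)).
rewrite mulrAC -mulrA; apply/negP; rewrite -ltNge.
rewrite -[ltRHS]mulr1 ltr_pM2l// ltr_pdivrMr// mul1r.
have := ler_norm B; lra.
Qed.

(** Comparing [p] with [l * y + (1 - l) * p] gives the subgradient inequality up to an error
    [l * ((y - p) ^+ 2 / 2)], which vanishes as [l] tends to 0. *)
Lemma subdifferential_of_min (R : realType) (f : R -> \bar R) (r p : R) :
  econvex f -> proper_fun f ->
  (forall s, (f p + ((p - r) ^+ 2 / 2)%:E <= f s + ((s - r) ^+ 2 / 2)%:E)%E) ->
  subdifferential *%R f p (r - p).
Proof.
move=> fcvx [fNy [t0 ft0]] pmin y.
move: (fNy p) (pmin t0); case fp : (f p) => [c||] // _; last first.
  by move: ft0 (fNy t0); case: (f t0).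
move=> _; case fy : (f y) (fNy y) => [d||] // _; last by rewrite leey.
rewrite -EFinD lee_fin -subr_le0.
apply: (@le0_of_le_small_mul _ _ ((y - p) ^+ 2 / 2)) => l l01.
have := pmin (l * y + (1 - l) * p); have := fcvx y p l l01.
rewrite fp fy -!EFinM -!EFinD.
case: (f _) (fNy (l * y + (1 - l) * p)) => [e||] // _.
rewrite -EFinD !lee_fin => h1 h2; case/andP: l01 => l0 l1.
rewrite -(ler_pM2l l0).
have -> : l * (l * ((y - p) ^+ 2 / 2)) = (l * y + (1 - l) * p - r) ^+ 2 / 2
   - (p - r) ^+ 2 / 2 - l * ((y - p) * (p - r)) by field.
have -> : l * ((y - p) * (r - p) + c - d) =
   l * c - l * d - l * ((y - p) * (p - r)) by ring.
lra.
Qed.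

(* A minimizing sequence of the strongly convex function
   [s |-> f s + (s - r)^2 / 2] is Cauchy by the parallelogram identity. *)
Lemma prox_objective_min (R : realType) (f : R -> \bar R) (r : R) :
  econvex f -> lower_semicontinuous f -> proper_fun f ->
  exists p, forall s,
    (f p + ((p - r) ^+ 2 / 2)%:E <= f s + ((s - r) ^+ 2 / 2)%:E)%E.
Proof.
move=> fcvx flsc fprop.
have [b [c [t0 [c0 fge]]]] := norm_minorant fcvx flsc fprop.
have [fNy [t1 ft1]] := fprop.
pose q (s : R) := (s - r) ^+ 2 / 2.
pose G := [set g : R | exists s, (f s + (q s)%:E = g%:E)%E].
have G0 : G !=set0.
  exists (fine (f t1) + q t1), t1.
  by rewrite EFinD fineK// fin_numElt fNy ft1.
have lbG : has_lbound G.
  (* The quadratic term absorbs the linear minorant: expanding [(|s - r| - c)^2 >= 0] bounds [q s]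
     below by [c * |s - r| - c ^+ 2 / 2]. *)
  exists (b - c ^+ 2 / 2 - c * `|r - t0|) => g [s].
  move: (fge s); case: (f s) => [d||] //; rewrite lee_fin => h [<-].
  have h1 : `|s - t0| <= `|s - r| + `|r - t0| by apply: ler_distD.
  have h2 : c * `|s - t0| <= c * (`|s - r| + `|r - t0|) by apply: ler_wpM2l.
  rewrite /q -(real_normK (num_real (s - r))).
  have := sqr_ge0 (`|s - r| - c); rewrite sqrrB.
  lra.
pose m := inf G.
have mle s : (m%:E <= f s + (q s)%:E)%E.
  case fs : (f s) (fNy s) => [d||] // _; last by rewrite addye// leey.
  rewrite -EFinD lee_fin.
  by apply: ge_inf => //; exists s; rewrite fs.
have /choice[s_ sP] : forall n : nat, exists s,
    (f s + (q s)%:E < (m + n.+1%:R^-1)%:E)%E.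
  move=> n; have [|g [s gs] gm] := @inf_adherent _ G n.+1%:R^-1 _ (conj G0 lbG).
    by rewrite invr_gt0.
  by exists s; rewrite gs lte_fin.
(* The objective is at least [m] at the midpoint of [s_ n] and [s_ k], while convexity of [f] and
   the identity for [q] bound it above by the average of the two values minus
   [(s_ n - s_ k) ^+ 2 / 8]. *)
have sdist n k : (s_ n - s_ k) ^+ 2 <= 4 * (n.+1%:R^-1 + k.+1%:R^-1).
  have := sP k; have := sP n; have := mle (2^-1 * s_ n + (1 - 2^-1) * s_ k).
  have half01 : 0 < (2^-1 : R) < 1.
    by rewrite invr_gt0 ltr0n invf_lt1 ?ltr1n ?ltr0n.
  have := fcvx (s_ n) (s_ k) _ half01.
  case: (f (s_ n)) (fNy (s_ n)) => [d||] // _.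
  case: (f (s_ k)) (fNy (s_ k)) => [e||] // _.
  case: (f _) (fNy (2^-1 * s_ n + (1 - 2^-1) * s_ k)) => [h||] // _.
  rewrite -!EFinM -!EFinD !lee_fin !lte_fin => h1 h2 h3 h4.
  have : q (2^-1 * s_ n + (1 - 2^-1) * s_ k) =
    2^-1 * q (s_ n) + 2^-1 * q (s_ k) - (s_ n - s_ k) ^+ 2 / 8.
    by rewrite /q; field.
  move: (m) (q (s_ n)) (q (s_ k)) (q _) (n.+1%:R^-1) (k.+1%:R^-1)
    ((s_ n - s_ k) ^+ 2) h1 h2 h3 h4 => *; lra.
have /cauchy_cvgP s_cvg : cauchy (s_ n @[n --> \oo]).
  apply: cauchy_exP => e e0.
  (* Two errors below [e ^+ 2 / 8] make the bound of [sdist] smaller than [e ^+ 2]. *)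
  have e80 : 0 < e ^+ 2 / 8 by rewrite divr_gt0// exprn_gt0.
  have [N _ NP] := near_infty_natSinv_lt (PosNum e80).
  exists (s_ N); exists N => // n /= Nn.
  rewrite /ball/= -(@ltr_pXn2r _ 2)// ?nnegrE ?(ltW e0)//.
  rewrite real_normK ?num_real//; apply: le_lt_trans (sdist _ _) _.
  have : n.+1%:R^-1 < e ^+ 2 / 8 := NP _ Nn.
  have : N.+1%:R^-1 < e ^+ 2 / 8 := NP _ (leqnn N).
  move: (e ^+ 2) (n.+1%:R^-1) (N.+1%:R^-1) => *; lra.
pose p := limn s_.
exists p => s; apply: le_trans (mle s); rewrite -/(q p).
have q_cvg : q (s_ n) @[n --> \oo] --> q p.
  apply: cvgMl; rewrite expr2; under eq_fun do rewrite expr2.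
  by apply: cvgM; apply: cvgB => //; apply: cvg_cst.
apply/lee_addgt0Pr => e e0; rewrite -EFinD.
suff : (f p <= (m + e - q p)%:E)%E.
  case: (f p) => [d||] //; rewrite -?EFinD ?lee_fin ?leNye//.
  by move: (q p) (m) => *; lra.
(* Otherwise lower semicontinuity keeps [f (s_ n)] above [m + e - q p] for large [n]. This
   contradicts [sP] once [q (s_ n)] is within [e / 2] of [q p] and [n.+1%:R^-1 < e / 2]. *)
rewrite leNgt; apply/negP => /flsc[V pV fV].
have e20 : 0 < e / 2 by rewrite divr_gt0.
near \oo => n.
have /fV : V (s_ n) by near: n; apply: s_cvg.
have := sP n; case: (f (s_ n)) (fNy (s_ n)) => [d||] // _.
rewrite -EFinD !lte_fin => h1 h2.
have h3 : `|q p - q (s_ n)| < e / 2 by near: n; move/cvgrPdist_lt: q_cvg; apply.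
have h4 : n.+1%:R^-1 < e / 2.
  by near: n; exact: (near_infty_natSinv_lt (PosNum e20)).
move: h3; rewrite ltr_norml => /andP[_].
move: (m) (q p) (q (s_ n)) (n.+1%:R^-1) h1 h2 h4 => *; lra.
Unshelve. all: by end_near. Qed.

(** Existence makes the value picked by [xget] a genuine solution of the inclusion rather than the
    default 0. *)
Lemma prox_real_subdifferential (R : realType) (f : R -> \bar R) (r : R) :
  econvex f -> lower_semicontinuous f -> proper_fun f ->
  subdifferential *%R f (prox *%R f r) (r - prox *%R f r).
Proof.
move=> fcvx flsc fprop; have [p pmin] := prox_objective_min r fcvx flsc fprop.
have fp := subdifferential_of_min fcvx fprop pmin.
have [fNy ffin] := fprop.
suff -> : prox *%R f r = p by [].
apply: prox_eq => // [w z|w z t|w ww]; [exact: mulNr|exact: mulrBr|].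
by apply/eqP; rewrite -sqrf_eq0 eq_le expr2 ww -expr2 sqr_ge0.
Qed.

(** * Orbits of the real proximity operator and their normalization *)

Lemma prox_real_firmly_nonexpansive (R : realType) (f : R -> \bar R) :
  econvex f -> lower_semicontinuous f -> proper_fun f ->
  let P := prox *%R f in
  forall r s : R, (P s - P r) ^+ 2 <= (P s - P r) * (s - r).
Proof.
move=> fcvx flsc fprop P r s; have [fNy ffin] := fprop.
have := subdifferential_monotone (@mulNr R) (@mulrBr R) fNy ffin
  (prox_real_subdifferential r fcvx flsc fprop)
  (prox_real_subdifferential s fcvx flsc fprop).
rewrite -/P; lra.
Qed.

Lemma firmly_nonexpansive_nondecreasing (R : realType) (P : R -> R) :
  (forall r s, (P s - P r) ^+ 2 <= (P s - P r) * (s - r)) ->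
  {homo P : r s / r <= s}.
Proof.
move=> PP r s rs; rewrite leNgt; apply/negP => lt_Ps.
have := PP r s; apply/negP; rewrite -ltNge.
rewrite expr2 ltr_nM2l ?subr_lt0//.
by rewrite (lt_le_trans _ (_ : 0 <= _)) ?subr_lt0 ?subr_ge0.
Qed.

Lemma firmly_nonexpansive_continuous (R : realType) (P : R -> R) :
  (forall r s, (P s - P r) ^+ 2 <= (P s - P r) * (s - r)) -> continuous P.
Proof.
move=> PP x; apply/cvgrPdist_lt => e e0; near=> y.
apply: (@le_lt_trans _ _ `|x - y|); last first.
  by near: y; apply: cvgr_dist_lt.
have [->|PxPy] := eqVneq (P x - P y) 0; first by rewrite normr0.
rewrite -(@ler_pM2l _ `|P x - P y|) ?normr_gt0// -normrM -expr2.
by rewrite ger0_norm ?sqr_ge0// -normrM (le_trans (PP _ _))// ler_norm.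
Unshelve. all: by end_near. Qed.

(** By continuity the shifted orbit tends to the image of the limit; it also tends to the limit
    itself. *)
Lemma iter_cvg_fixed (R : realType) (P : R -> R) (t : R) :
  continuous P -> cvgn (fun n => iter n P t) -> exists l, P l = l.
Proof.
move=> Pc cv; exists (limn (fun n => iter n P t)).
apply: (@cvg_unique _ (@Rhausdorff R) (iter n.+1 P t @[n --> \oo])).
  by apply: (@cvg_comp _ _ _ (fun n => iter n P t) P _ _ _ cv); exact: Pc.
by have := cv; rewrite -(cvg_shiftS (fun n => iter n P t)).
Qed.

(** The first step decides the direction, and monotonicity of [P] propagates it along the orbit; a
    monotone sequence that does not converge is unbounded. *)
Lemma iter_dvg (R : realType) (P : R -> R) (t : R) :
  {homo P : r s / r <= s} -> continuous P -> (forall r, P r <> r) ->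
  iter n P t @[n --> \oo] --> +oo \/ iter n P t @[n --> \oo] --> -oo.
Proof.
move=> Pmono Pc Pfix.
have ncv : ~ cvgn (fun n => iter n P t).
  by move=> /(iter_cvg_fixed Pc)[l]; exact: Pfix.
have [tP|Pt] := leP t (P t).
  left; apply: nondecreasing_dvgn_lt => //.
  apply/nondecreasing_seqP => n.
  by elim: n => //= n; exact: Pmono.
right; apply/cvgNry; apply: nondecreasing_dvgn_lt.
  apply/nondecreasing_seqP => n; rewrite /= lerN2.
  by elim: n => [|n] /=; [exact: ltW|exact: Pmono].
by move/is_cvgN; rewrite opprK.
Qed.

(** Once [s n] is positive it factors out as [s n *: v n] with [v n] tending to [b], and
    normalization cancels this factor. *)
Lemma normalized_line_cvg (R : realType) (X : normedModType R) (p b : X)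
    (s : R^nat) : `|b| = 1 -> s n @[n --> \oo] --> +oo ->
  (\forall n \near \oo, p + s n *: b != 0) /\
  `|p + s n *: b|^-1 *: (p + s n *: b) @[n --> \oo] --> b.
Proof.
move=> b1 soo.
have s0 : \forall n \near \oo, 0 < s n by move/cvgryPgt : soo; apply.
pose v n := (s n)^-1 *: p + b.
have vE : \forall n \near \oo, p + s n *: b = s n *: v n.
  near=> n; rewrite /v scalerDr scalerA divff ?scale1r//.
  by rewrite gt_eqF//; near: n.
have vb : v n @[n --> \oo] --> b.
  rewrite -[X in _ --> X]add0r -[in X in _ --> X](scale0r p).
  apply: cvgD; last exact: cvg_cst.
  by apply: cvgZr_tmp; apply/(gtr0_cvgV0 s0).
have b0 : b != 0 by rewrite -normr_eq0 b1 oner_eq0.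
have v0 := cvgr_neq0 _ vb b0.
split.
  near=> n; have -> : p + s n *: b = s n *: v n by near: n.
  rewrite scaler_eq0 negb_or; apply/andP; split; last by near: n; exact: v0.
  by rewrite gt_eqF//; near: n.
have : `|v n|^-1 *: v n @[n --> \oo] --> b.
  rewrite -[X in _ --> X]scale1r -[in X in _ --> X](invr1 R) -b1.
  apply: cvgZ => //; apply: cvgV; first by rewrite b1 oner_eq0.
  exact: cvg_norm.
apply: cvg_trans; apply: near_eq_cvg; near=> n.
have sn0 : 0 < s n by near: n.
have -> : p + s n *: b = s n *: v n by near: n.
by rewrite normrZ gtr0_norm// invfM scalerA mulrAC mulVf ?gt_eqF// mul1r.
Unshelve. all: by end_near. Qed.

(** * Reduction from [X] to the line spanned by [a] *)

Lemma dot_symm (R : realType) (X : lmodType R) (dot : {dot X for idfun})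
    (u v : X) : dot u v = dot v u.
Proof. by rewrite hermC expr0 mul1r. Qed.

Lemma dot_le0 (R : realType) (X : lmodType R) (dot : {dot X for idfun})
    (u : X) : dot u u <= 0 -> u = 0.
Proof.
move=> uu; apply/eqP; apply: contraTT uu => /(@neq0_dnorm_gt0 _ _ _ dot).
by rewrite ltNge.
Qed.

(** For uniqueness, the difference of two candidates lies in the orthogonal of [a] and is orthogonal
    to that subspace, hence to itself. *)
Lemma orthogonal_projector_orthogonal1 (R : realType) (X : lmodType R)
    (dot : {dot X for idfun}) (a x : X) : dot a a = 1 ->
  orthogonal_projector dot (orthogonal_set dot [set a]) x = x - dot a x *: a.
Proof.
move=> aa; apply: xget_subset1.
  split=> [z ->|z az]; first by rewrite linearBr linearZr_LR /= aa mulr1 subrr.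
  by rewrite opprB addrC subrK linearZr_LR /= (dot_symm dot z a) az// mulr0.
move=> p q [ap xp] [aq xq]; apply/eqP; rewrite -subr_eq0; apply/eqP.
apply: (@dot_le0 _ _ dot).
have apq : orthogonal_set dot [set a] (p - q).
  by move=> z za; rewrite linearBr /= ap// aq// subrr.
have -> : dot (p - q) (p - q) = dot (p - q) ((x - q) - (x - p)).
  by congr (dot _ _); rewrite opprB [RHS]addrC addrA subrK.
by rewrite linearBr /= xp// xq// subrr.
Qed.

(** The candidate has coordinate [s = prox *%R f (dot a y)], and [y] minus it is
    [(dot a y - s) *: a], so its subgradient inequality for [F] is that of [f] at [s], tested at
    [dot a z]. *)
Lemma prox_dot (R : realType) (X : lmodType R) (dot : {dot X for idfun})
    (f : R -> \bar R) (a y : X) :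
  econvex f -> lower_semicontinuous f -> proper_fun f -> dot a a = 1 ->
  prox dot (fun z => f (dot a z)) y =
    y + (prox *%R f (dot a y) - dot a y) *: a.
Proof.
move=> fcvx flsc fprop aa; have [fNy [t ft]] := fprop.
apply: prox_eq => [w z|w z u||||z] //.
- exact: linearNl.
- exact: linearBr.
- exact: dot_le0.
- by exists (t *: a); rewrite linearZr_LR /= aa mulr1.
have := prox_real_subdifferential (dot a y) fcvx flsc fprop (dot a z).
set s := prox _ _ _ => h.
have dE : dot a (y + (s - dot a y) *: a) = s.
  by rewrite linearDr linearZr_LR /= aa mulr1 addrC subrK.
rewrite dE.
suff -> : dot (z - (y + (s - dot a y) *: a)) (y - (y + (s - dot a y) *: a))
  = (dot a z - s) * (dot a y - s) by [].
have -> : y - (y + (s - dot a y) *: a) = (dot a y - s) *: a.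
  by rewrite opprD addrA subrr add0r -scaleNr opprB.
by rewrite linearZr_LR /= (dot_symm dot _ a) linearBr /= dE mulrC.
Qed.

Lemma iter_prox_dot (R : realType) (X : lmodType R) (dot : {dot X for idfun})
    (f : R -> \bar R) (a x : X) (n : nat) :
  econvex f -> lower_semicontinuous f -> proper_fun f -> dot a a = 1 ->
  iter n (prox dot (fun z => f (dot a z))) x =
    x - dot a x *: a + iter n (prox *%R f) (dot a x) *: a.
Proof.
move=> fcvx flsc fprop aa; elim: n => [|n IHn] /=; first by rewrite subrK.
rewrite IHn prox_dot//.
have -> : dot a (x - dot a x *: a + iter n (prox *%R f) (dot a x) *: a) =
    iter n (prox *%R f) (dot a x).
  by rewrite linearDr linearBr !linearZr_LR /= aa !mulr1 subrr add0r.
by rewrite -addrA -scalerDl addrCA subrr addr0.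
Qed.

(** At a fixed point the inclusion says that 0 is a subgradient. *)
Lemma fixed_point_prox_minimizer (R : realType) (f : R -> \bar R) (t : R) :
  econvex f -> lower_semicontinuous f -> proper_fun f ->
  prox *%R f t = t -> minimizer f t.
Proof.
move=> fcvx flsc fprop Pt s.
have := prox_real_subdifferential t fcvx flsc fprop s.
by rewrite Pt subrr mulr0 add0e.
Qed.

Theorem corollary2p8 (R : realType) (X : normedModType R)
    (dot : {dot X for idfun})
    (normE : norm_of_dot dot) (fdX : finite_dimensional X)
    (f : R -> \bar R)
    (f_convex : econvex f) (f_lsc : lower_semicontinuous f)
    (f_proper : proper_fun f)
    (a : X) (a_unit : `|a| = 1) (x : X) :
  let F : X -> \bar R := fun y => f (dot a y) in
  let T := prox dot F in
  let Pf := prox *%R f in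
  (forall n : nat,
     iter n T x =
       orthogonal_projector dot (orthogonal_set dot [set a]) x
       + iter n Pf (dot a x) *: a)
  /\
  (bounded_below_fun f -> ~ (exists t, minimizer f t) ->
     cosmic_convergence T
     /\ (cosmic_seq T x n @[n --> \oo] --> a
         \/ cosmic_seq T x n @[n --> \oo] --> - a)).
Proof.
have aa : dot a a = 1.
  have : 0 <= dot a a.
    have [->|/(@neq0_dnorm_gt0 _ _ _ dot)/ltW//] := eqVneq a 0.
    by rewrite linear0r.
  by move=> /sqr_sqrtr <-; rewrite -normE a_unit expr1n.
move=> F T Pf; split=> [n|_ no_min].
  by rewrite orthogonal_projector_orthogonal1//; exact: iter_prox_dot.
have TE y n : iter n T y = (y - dot a y *: a) + iter n Pf (dot a y) *: a.
  exact: iter_prox_dot.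
have Pfne := prox_real_firmly_nonexpansive f_convex f_lsc f_proper.
(* Leaving [b] and [s] free treats both limits at once: an orbit tending to [-oo] along [a] is its
   opposite tending to [+oo] along [- a]. *)
have line_cvg y b (s : R^nat) : `|b| = 1 -> s n @[n --> \oo] --> +oo ->
    (forall n, iter n Pf (dot a y) *: a = s n *: b) ->
    (\forall n \near \oo, iter n T y != 0) /\
    cosmic_seq T y n @[n --> \oo] --> b.
  move=> b1 soo sE; have {}TE n : iter n T y = y - dot a y *: a + s n *: b.
    by rewrite TE sE.
  have [n0 cv] := normalized_line_cvg (y - dot a y *: a) b1 soo.
  split; first by apply: filterS n0 => n; rewrite TE.
  by rewrite /cosmic_seq; under eq_fun do rewrite TE.
have key y : (\forall n \near \oo, iter n T y != 0) /\
    (cosmic_seq T y n @[n --> \oo] --> a \/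
     cosmic_seq T y n @[n --> \oo] --> - a).
  have [Poo|/cvgNry PNoo] : iter n Pf (dot a y) @[n --> \oo] --> +oo \/
      iter n Pf (dot a y) @[n --> \oo] --> -oo.
    apply: iter_dvg => [||r Pr].
    - exact: firmly_nonexpansive_nondecreasing.
    - exact: firmly_nonexpansive_continuous.
    - by apply: no_min; exists r; exact: fixed_point_prox_minimizer.
  - by have [//|n0 cv] := line_cvg y a _ a_unit Poo; split=> //; left.
  - have [|n|n0 cv] := line_cvg y (- a) _ _ PNoo; first by rewrite normrN.
      by rewrite scalerN scaleNr opprK.
    by split=> //; right.
split=> [y|]; last by have [] := key x.
have [n0 cv] := key y; split=> //.
by case: cv => cv; apply/cvg_ex; [exists a|exists (- a)].
Qed.
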